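(* Let $\varphi:\mathbb{R}^n\to\mathbb{R}\cup\{+\infty\}$ be a proper, lower semicontinuous, coercive function that is uniformly quasiconvex with modulus $\phi$ on a nonempty closed convex set $C\subseteq\operatorname{dom}\varphi$. Let $\{x^k\}_{k\ge0}$ be a sequence generated by HiPPA with order $p>1$ and parameters $\gamma_k\in(\gamma_{\min},\gamma_{\max})$, and let $\{\overline{x}\}=\arg\min_{x\in C}\varphi(x)$. For a given $\varepsilon>0$ let $\mathcal{N}^{\varphi}(\varepsilon)$ denote the number of iterations to reach $\varphi(x^k)-\varphi(\overline{x})<\varepsilon$. Then the following statements hold: (a) Suppose that for some $q\in(1,2)$ and some $\rho_q>0$ we have $\rho_qt^q\le\phi(t)$ on $[0,1)$, that $p\in[q,2)$, and that $\gamma_{\min}>\frac1{\rho_q}$. If the sequence starts within the unit ball centered at the minimizer $\overline{x}$ and remains there, then for a given $\varepsilon\in(0,1)$, $$\mathcal{N}^{\varphi}(\varepsilon)\le\left\lceil2+\frac{\log(\varepsilon^{-1})+\log\left(\frac{\|x^0-\overline{x}\|^p}{p\gamma_{\min}}\right)}{p\log(1/\mu)}\right\rceil,$$ where $\mu:=(\rho_q\gamma_{\min})^{-\frac{1}{p-1}}$. In particular, the local iteration complexity is $\mathcal{O}(\log(\varepsilon^{-1}))$. (b) If for some $\rho>0$ we have $\rho t^2\le\phi(t)$ on $[0,+\infty)$ and $p=2$, then for a given $\varepsilon>0$, $$\mathcal{N}^{\varphi}(\varepsilon)\le\left\lceil2+\frac{\log(\varepsilon^{-1})+\log\left(\frac{\|x^0-\overline{x}\|^p}{p\gamma_{\min}}\right)}{p\log(1+\rho\gamma_{\min})}\right\rceil.$$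 In particular, the iteration complexity in function value is $\mathcal{O}(\log(\varepsilon^{-1}))$. (c) If $p>2$ and for some $\rho_p>0$ we have $\rho_pt^p\le\phi(t)$ on $[0,+\infty)$, then by choosing $\gamma_{\min}>\frac1{\rho_p}$, for a given $\varepsilon>0$, $$\mathcal{N}^{\varphi}(\varepsilon)\le\left\lceil2+\frac{\log(\varepsilon^{-1})+\log\left(\frac{\|x^0-\overline{x}\|^p}{p\gamma_{\min}}\right)}{\frac{1}{p-1}\left(\log(p\gamma_{\min}\rho_p+\widehat{\sigma}_p)-\log(p)\right)}\right\rceil,$$ where $\widehat{\sigma}_p=\left(\frac12\right)^{\frac{3p-2}{2}}$. In particular, the iteration complexity in function value is $\mathcal{O}(\log(\varepsilon^{-1}))$. (d) Suppose that for some $q\ge2$ there exists $\rho_q>0$ such that $\rho_qt^q\le\phi(t)$ on $[0,+\infty)$, that $p>q$, and that $\|x^0-\overline{x}\|\le c^{-\frac{q-1}{p-q}}$, where $c:=(\gamma_{\min}\rho_q)^{\frac{-1}{q-1}}$. Then for a given $\varepsilon>0$, $$\mathcal{N}^{\varphi}(\varepsilon)\le\left\lceil2+\frac{\log\left(\log\left(c^{-\frac{p}{\alpha-1}}(p\gamma_{\min})^{-1}\varepsilon^{-1}\right)\right)-\log\left(p\log(u_0^{-1})\right)}{\log(\alpha)}\right\rceil,$$ where $\alpha:=\frac{p-1}{q-1}$ and $u_0=c^{\frac{1}{\alpha-1}}\|x^0-\overline{x}\|$. In particular, $$\log\left(\log\left(c^{-\frac{p}{\alpha-1}}(p\gamma_{\min})^{-1}\varepsilon^{-1}\right)\right)\ge\log\left(p\log(u_0^{-1})\right),$$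 and the iteration complexity in function value is $\mathcal{O}(\log(\log(\varepsilon^{-1})))$.
   Context: $\|\cdot\|$ is the Euclidean norm on $\mathbb{R}^n$; $\operatorname{dom}\varphi=\{x:\varphi(x)<+\infty\}$; $\varphi$ is proper if $\operatorname{dom}\varphi\ne\emptyset$, and coercive if $\varphi(x)\to+\infty$ as $\|x\|\to+\infty$. $\lceil a\rceil$ is the smallest integer greater than or equal to $a$. A modulus is an increasing function $\phi:[0,+\infty)\to[0,+\infty]$ that vanishes only at $0$. The function $\varphi$ is uniformly quasiconvex with modulus $\phi$ on a convex set $C\subseteq\operatorname{dom}\varphi$ if for all $x,y\in C$ and $\lambda\in[0,1]$, $$\varphi(\lambda x+(1-\lambda)y)+\lambda(1-\lambda)\phi(\|x-y\|)\le\max\{\varphi(x),\varphi(y)\}.$$ HiPPA (high-order proximal-point algorithm) of order $p>1$: fix $\gamma_{\max}>\gamma_{\min}>0$ and $x^0\in C$; for $k=0,1,2,\dots$, while the stopping criteria do not hold, select $\gamma_k\in(\gamma_{\min},\gamma_{\max})$ and compute $$x^{k+1}\in\arg\min_{y\in C}\left(\varphi(y)+\frac{1}{p\gamma_k}\|x^k-y\|^p\right).$$ (Under the hypotheses of the claim these sets of minimizers are nonempty, and $\varphi$ has a unique minimizer $\overline{x}$ on $C$.)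
   Formalization: The bounds are proved as N(ε) ≤ max(1, ⌈…⌉), since the ceiling can be negative or undefined for large ε or small ‖x⁰−x̄‖; the log-log inequality in (d) is stated for ε ≤ ‖x⁰−x̄‖^p/(pγ_min), its exact range of validity. *)

(* Defs.v *)
From HB Require Import structures.
From mathcomp Require Import all_boot all_order all_algebra.
From mathcomp Require Import all_classical all_reals all_analysis.
Set Implicit Arguments.
Unset Strict Implicit.
Unset Printing Implicit Defensive.
Import Order.TTheory GRing.Theory Num.Theory.
Import numFieldNormedType.Exports.
Local Open Scope classical_set_scope.
Local Open Scope ring_scope.

(* The library norm `|x| on 'rV[R]_n is the sup norm, so the Euclidean norm is
   defined here. Both induce the same topology, hence closedness and lower
   semicontinuity below are the library's. *)
Definition enorm (R : realType) (n : nat) (x : 'rV[R]_n) : R :=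
  Num.sqrt (\sum_(i < n) x 0 i ^+ 2).

Definition edom (T : Type) (R : realType) (f : T -> \bar R) : set T :=
  [set x | (f x < +oo)%E].

(* Functions into R \cup {+oo} are extended-real functions avoiding -oo. *)
Definition eproper (T : Type) (R : realType) (f : T -> \bar R) : Prop :=
  (forall x, f x != -oo%E) /\ edom f !=set0.

Definition coercive (R : realType) (n : nat) (f : 'rV[R]_n -> \bar R) : Prop :=
  forall A : R, exists M : R, forall x, M < enorm x -> (A%:E < f x)%E.

(* Only the values on [0, +oo) matter; "increasing" is in the wide sense, which
   is the weaker requirement (and +oo may be taken at several points). *)
Definition modulus (R : realType) (phi : R -> \bar R) : Prop :=
  [/\ forall t, 0 <= t -> (0 <= phi t)%E,
      forall s t, 0 <= s -> s <= t -> (phi s <= phi t)%E &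
      forall t, 0 <= t -> (phi t = 0%E <-> t = 0)].

Definition uniformly_quasiconvex (R : realType) (n : nat)
    (phi : R -> \bar R) (C : set 'rV[R]_n) (f : 'rV[R]_n -> \bar R) : Prop :=
  forall x y (l : R), C x -> C y -> 0 <= l -> l <= 1 ->
    (f (l *: x + (1 - l) *: y)%R + (l * (1 - l))%:E * phi (enorm (x - y))
       <= maxe (f x) (f y))%E.

Definition argmin (T : Type) (R : realType) (C : set T) (g : T -> \bar R)
    : set T :=
  [set z | C z /\ forall y, C y -> (g z <= g y)%E].

Definition hippa (R : realType) (n : nat) (f : 'rV[R]_n -> \bar R)
    (C : set 'rV[R]_n) (p gmin gmax : R) (gamma : nat -> R)
    (x : nat -> 'rV[R]_n) : Prop :=
  C (x 0%N) /\
  forall k, [/\ gmin < gamma k, gamma k < gmax &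
    argmin C (fun y => (f y + ((p * gamma k)^-1 * enorm (x k - y) `^ p)%:E)%E)
      (x k.+1)].

(* Least k with f (x k) - f xbar < e, and +oo if there is none. *)
Definition nb_iter (T : Type) (R : realType) (f : T -> \bar R) (xbar : T)
    (x : nat -> T) (e : R) : \bar R :=
  ereal_inf [set k%:R%:E | k in [set k | (f (x k) - f xbar < e%:E)%E]].

Definition ceile (R : realType) (b : \bar R) : \bar R :=
  if b is r%:E then (Num.ceil r)%:~R%:E else b.

(* N e = O(g e) as e -> 0+; in particular N is finite near 0. *)
Definition bigO_at0 (R : realType) (N : R -> \bar R) (g : R -> R) : Prop :=
  exists K : R, \forall e \near 0^'+, (N e <= (K * `|g e|)%:E)%E.

(* Main.v *)
(* Write r_k for the distance from x^k to the minimizer. Comparing x^(k+1) with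
   the minimizer in the proximal problem gives f(x^(k+1)) - min f <= r_k^p / (p gamma_k)
   and |x^k - x^(k+1)| <= r_k. Comparing it with points of the segment towards
   the minimizer, where uniform quasiconvexity improves f, and letting these
   points tend to x^(k+1) gives
     gamma_k phi(r_(k+1)) <= r_(k+1) |x^k - x^(k+1)|^(p-1).
   A lower bound rho t^q on the modulus phi turns this into
   gamma_k rho r_(k+1)^(q-1) <= r_k^(p-1): a linear contraction or, for q < p,
   one of order (p-1)/(q-1). For p = 2 the exact inner product in place of
   Cauchy-Schwarz gives the rate 1 + rho gmin. *)

Require Import Defs.
From HB Require Import structures.
From mathcomp Require Import all_boot all_order all_algebra.
From mathcomp Require Import all_classical all_reals all_analysis.
From mathcomp Require Import ring lra.
Set Implicit Arguments.
Unset Strict Implicit.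
Import Order.TTheory GRing.Theory Num.Theory.
Import numFieldNormedType.Exports.
Local Open Scope classical_set_scope.
Local Open Scope ring_scope.

(** * Euclidean geometry and real powers *)

Definition dot (R : realType) (n : nat) (x y : 'rV[R]_n) : R :=
  \sum_(i < n) x 0 i * y 0 i.

Section Euclidean.
Variables (R : realType) (n : nat).
Implicit Types (x y z : 'rV[R]_n) (l : R).

Lemma dotC x y : dot x y = dot y x.
Proof. by apply: eq_bigr => i _; rewrite mulrC. Qed.

Lemma dotDl x y z : dot (x + y) z = dot x z + dot y z.
Proof. by rewrite -big_split; apply: eq_bigr => i _; rewrite mxE mulrDl. Qed.

Lemma dotZl l x y : dot (l *: x) y = l * dot x y.
Proof. by rewrite mulr_sumr; apply: eq_bigr => i _; rewrite mxE mulrA. Qed.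

Lemma dot0l x : dot 0 x = 0.
Proof. by rewrite /dot big1// => i _; rewrite mxE mul0r. Qed.

Lemma enorm_ge0 x : 0 <= enorm x.
Proof. exact: sqrtr_ge0. Qed.

Lemma enorm_sqr x : enorm x ^+ 2 = dot x x.
Proof.
by rewrite sqr_sqrtr ?sumr_ge0// => i _; exact: sqr_ge0.
Qed.

Lemma enorm_eq0 x : enorm x = 0 -> x = 0.
Proof.
move=> x0; apply/rowP => i; rewrite mxE; apply/eqP; rewrite -sqrf_eq0 expr2.
have := enorm_sqr x; rewrite x0 expr0n => /esym/eqP.
by rewrite psumr_eq0 => [/allP/(_ i (mem_index_enum _))//|j _]; exact: sqr_ge0.
Qed.

Lemma enormN x : enorm (- x) = enorm x.
Proof.
by congr Num.sqrt; apply: eq_bigr => i _; rewrite mxE sqrrN.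
Qed.

Lemma enormB x y : enorm (x - y) = enorm (y - x).
Proof. by rewrite -opprB enormN. Qed.

Lemma enormD_sqr x y l :
  enorm (x + l *: y) ^+ 2 = enorm x ^+ 2 + 2 * l * dot x y + l ^+ 2 * enorm y ^+ 2.
Proof.
rewrite !enorm_sqr !dotDl (dotC x (x + _)) (dotC (l *: y) (x + _)) !dotDl.
rewrite !dotZl (dotC x (l *: y)) (dotC y (l *: y)) !dotZl (dotC y x); ring.
Qed.

Lemma dot_le_enorm x y : dot x y <= enorm x * enorm y.
Proof.
have [/enorm_eq0 ->|y0] := eqVneq (enorm y) 0.
  by rewrite dotC dot0l mulr_ge0 ?enorm_ge0.
have yp : 0 < enorm y by rewrite lt_neqAle eq_sym y0 enorm_ge0.
have xp := enorm_ge0 x.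
(* The coefficient [enorm x / enorm y] makes the expanded square a multiple of
   [enorm x * enorm y - dot x y]. *)
have := sqr_ge0 (enorm (x + (- (enorm x / enorm y)) *: y)).
rewrite enormD_sqr.
have -> : enorm x ^+ 2 + 2 * - (enorm x / enorm y) * dot x y +
   (- (enorm x / enorm y)) ^+ 2 * enorm y ^+ 2 =
   2 * enorm x / enorm y * (enorm x * enorm y - dot x y) by field.
have [/enorm_eq0 ->|x0] := eqVneq (enorm x) 0.
  by move=> _; rewrite dot0l mulr_ge0 ?enorm_ge0.
have xp' : 0 < enorm x by rewrite lt_neqAle eq_sym x0 enorm_ge0.
by rewrite pmulr_rge0 ?subr_ge0// divr_gt0// mulr_gt0.
Qed.

Lemma enorm_triangle x y l : 0 <= l -> enorm (x + l *: y) <= enorm x + l * enorm y.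
Proof.
move=> l0; have [x0 y0] := (enorm_ge0 x, enorm_ge0 y).
rewrite -ler_sqr ?nnegrE ?enorm_ge0 ?addr_ge0 ?mulr_ge0//.
have := ler_wpM2l l0 (dot_le_enorm x y); rewrite enormD_sqr; lra.
Qed.

End Euclidean.

Section RealInequalities.
Variable R : realType.
Implicit Types a b g l t p v : R.

(** Replaces the passage to the limit as [l] tends to 0 in the segment arguments. *)
Lemma le_of_le_addM (A B K : R) :
  (forall l, 0 < l -> l < 1 -> A <= B + l * K) -> A <= B.
Proof.
move=> H; rewrite leNgt; apply/negP => BA.
have dp : 0 < `|K| + (A - B) + 1 by rewrite addr_gt0// ltr_wpDl// subr_gt0.
(* Small enough that [l] times the absolute value of [K] stays below [A - B]. *)
pose l := (A - B) / (`|K| + (A - B) + 1).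
have l0 : 0 < l by rewrite divr_gt0// subr_gt0.
have l1 : l < 1 by rewrite ltr_pdivrMr// mul1r -addrA ltr_wpDl ?ltrDl.
have := H l l0 l1; apply/negP; rewrite -ltNge -ltrBrDl.
apply: (@le_lt_trans _ _ (l * `|K|)); first by rewrite ler_wpM2l ?ler_norm// ltW.
rewrite /l mulrAC ltr_pdivrMr// ltr_pM2l ?subr_gt0// -addrA ltrDl.
by rewrite ltr_wpDl// ltW// subr_gt0.
Qed.

(* The tangent of the convex function [t `^ p], in the form of Young's
   inequality for [a] and [t `^ (p - 1)]. *)
Lemma powR_tangent a t p : 1 < p -> 0 <= a -> 0 <= t ->
  t `^ p - a `^ p <= p * t `^ (p - 1) * (t - a).
Proof.
move=> p1 a0 t0; have p0 : 0 < p by lra.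
have q0 : 0 < p / (p - 1) by rewrite divr_gt0//; lra.
have := @conjugate_powR R a (t `^ (p - 1)) p (p / (p - 1)) a0 (powR_ge0 _ _) p0 q0.
have -> : p^-1 + (p / (p - 1))^-1 = 1 by field; apply/andP; split; lra.
move=> /(_ erefl); rewrite -powRrM.
have -> : (p - 1) * (p / (p - 1)) = p by field; lra.
rewrite -(@ler_pM2l _ p)// mulrDr.
have -> : p * (a `^ p / p) = a `^ p by field; lra.
have -> : p * (t `^ p / (p / (p - 1))) = (p - 1) * t `^ p by field; apply/andP; split; lra.
have := mulr_powRB1 t0 p0; nra.
Qed.

(** Dividing by [l] and letting it tend to 0 compares the slope p g v with the derivative p b
    a^(p-1). The proof needs only the tangent bound, at points slightly above [a]. *)
Lemma powR_increment p a b g v : 1 < p -> 0 <= a -> 0 < b -> 0 < g ->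
  (forall l, 0 < l -> l < 1 ->
     p * g * (l * (1 - l)) * v + a `^ p <= (a + l * b) `^ p) ->
  g * v <= b * a `^ (p - 1).
Proof.
move=> p1 a0 b0 g0 H; rewrite leNgt; apply/negP => lt.
have p1' : 0 < p - 1 by lra.
have v0 : 0 < g * v / b.
  by rewrite divr_gt0//; apply: le_lt_trans lt; rewrite mulr_ge0 ?powR_ge0// ltW.
(* [y] solves b y^(p-1) = g v, so the negated conclusion says [a < y]; the midpoint [h] still
   violates the bound. *)
pose y := (g * v / b) `^ (p - 1)^-1.
have yE : b * y `^ (p - 1) = g * v.
  rewrite -powRrM mulVf ?gt_eqF// powRr1 ?(ltW v0)//; field; lra.
have ay : a < y.
  rewrite ltNge; apply/negP => ya; move: lt; apply/negP; rewrite -leNgt -yE.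
  apply: ler_wpM2l; first exact: ltW.
  by apply: ge0_ler_powR; rewrite ?nnegrE ?powR_ge0// ltW.
pose h := (a + y) / 2.
have [ah hy] : a < h /\ h < y by split; rewrite /h; lra.
have : g * v <= b * h `^ (p - 1).
  (* Scaling by [m] keeps [a + l * m * b] below [h] for every [l] in (0, 1). *)
  pose m := Num.min 1 ((h - a) / b).
  have m0 : 0 < m by rewrite /m lt_min ltr01 divr_gt0//; lra.
  apply: (@le_of_le_addM _ _ (m * (g * v))) => l l0 l1.
  have lm0 : 0 < l * m by rewrite mulr_gt0.
  have m1 : m <= 1 by rewrite /m ge_min lexx.
  have lm1 : l * m < 1 by nra.
  have mb : m * b <= h - a by rewrite -ler_pdivlMr// /m ge_min lexx orbT.
  have lh : a + l * m * b <= h.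
    rewrite -lerBrDl; apply: le_trans mb.
    by rewrite -mulrA ger_pMl ?mulr_gt0// ltW.
  have := H _ lm0 lm1.
  have t0 : 0 <= a + l * m * b by rewrite addr_ge0// ltW// mulr_gt0.
  have := powR_tangent p1 a0 t0.
  have -> : a + l * m * b - a = l * m * b by ring.
  have : (a + l * m * b) `^ (p - 1) <= h `^ (p - 1).
    by apply: ge0_ler_powR; rewrite ?nnegrE//; lra.
  set P := (_ + _) `^ (p - 1); set Q := h `^ _ => PQ tan hyp.
  have : p * (l * m) * (g * (1 - l * m) * v) <= p * (l * m) * (b * P) by lra.
  rewrite ler_pM2l; last by rewrite mulr_gt0//; lra.
  have := ler_wpM2l (ltW b0) PQ; lra.
apply/negP; rewrite -ltNge -yE ltr_pM2l// gt0_ltr_powR ?nnegrE//; lra.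
Qed.

End RealInequalities.

(** * One proximal step *)

Section ProximalStep.
Variables (R : realType) (n : nat) (f : 'rV[R]_n -> \bar R) (phi : R -> \bar R).
Implicit Types l v : R.
Variables (C : set 'rV[R]_n) (p g : R) (x x' xbar : 'rV[R]_n).
Hypotheses (f_proper : eproper f) (C_dom : C `<=` edom f).
Hypothesis C_convex : convex_set (C : set (convex_lmodType 'rV[R]_n)).
Hypotheses (phi_modulus : modulus phi) (f_uqc : uniformly_quasiconvex phi C f).
Hypotheses (p_gt1 : 1 < p) (g_gt0 : 0 < g) (xbarP : argmin C f xbar).
Hypothesis x'P :
  argmin C (fun y => (f y + ((p * g)^-1 * enorm (x - y) `^ p)%:E)%E) x'.

Let r := enorm (x - xbar).
Let r' := enorm (x' - xbar).
Let d := enorm (x - x').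
Let dr := dot (x - x') (x' - xbar).

Let pg_gt0 : 0 < p * g. Proof. by rewrite mulr_gt0// (lt_trans ltr01 p_gt1). Qed.

Let p_gt0 : 0 < p. Proof. exact: lt_trans p_gt1. Qed.

Let f_fin y : C y -> f y \is a fin_num.
Proof.
by move=> /C_dom; rewrite fin_numE => /lt_eqF ->; rewrite (proj1 f_proper y).
Qed.

Let real_step y : C y ->
  fine (f x') + (p * g)^-1 * d `^ p <= fine (f y) + (p * g)^-1 * enorm (x - y) `^ p.
Proof.
move=> Cy; have := x'P.2 _ Cy.
by rewrite -(fineK (f_fin Cy)) -(fineK (f_fin x'P.1)) -!EFinD lee_fin.
Qed.

Let min_xbar : fine (f xbar) <= fine (f x').
Proof.
have := xbarP.2 _ x'P.1.
by rewrite -(fineK (f_fin xbarP.1)) -(fineK (f_fin x'P.1)) lee_fin.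
Qed.

Lemma prox_gap_le : (f x' - f xbar <= ((p * g)^-1 * r `^ p)%:E)%E.
Proof.
rewrite -(fineK (f_fin xbarP.1)) -(fineK (f_fin x'P.1)) -EFinB lee_fin.
rewrite lerBlDl; apply: le_trans (real_step xbarP.1).
by rewrite lerDl mulr_ge0 ?powR_ge0// invr_ge0 ltW.
Qed.

Lemma prox_displacement_le : d <= r.
Proof.
have : (p * g)^-1 * d `^ p <= (p * g)^-1 * r `^ p.
  rewrite -(lerD2l (fine (f xbar))); apply: le_trans (real_step xbarP.1).
  by rewrite lerD2r min_xbar.
rewrite ler_pM2l ?invr_gt0// => dr_p; rewrite leNgt; apply/negP => rd.
move: dr_p; apply/negP; rewrite -ltNge.
by apply: gt0_ltr_powR; rewrite ?nnegrE ?enorm_ge0.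
Qed.

(** The test point [y] lies on the segment from [x'] to [xbar], whose larger endpoint value is
    [f x']. The real [v] stands in for [phi r'], which may be +oo. *)
Lemma prox_segment v l : 0 < l -> l < 1 -> (v%:E <= phi r')%E ->
  p * g * (l * (1 - l)) * v + d `^ p <= enorm (x - x' + l *: (x' - xbar)) `^ p.
Proof.
move=> l0 l1 vphi; pose y := l *: xbar + (1 - l) *: x'.
have Cy : C y.
  (* [convex_set] takes its scalar from an interval type, so [l] is packed with its bounds. *)
  have l01 : Itv.spec (@Itv.num_sem R) (Itv.Real `[0%Z, 1%Z]) l.
    by rewrite /= /Itv.num_sem/= num_real/= in_itv/= !ltW.
  have /set_mem := C_convex (Itv.mk l01) (mem_set xbarP.1) (mem_set x'P.1).
  by [].
have := f_uqc xbarP.1 x'P.1 (ltW l0) (ltW l1).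
rewrite enormB -/r' -/y.
have ll0 : 0 < l * (1 - l) by rewrite mulr_gt0//; lra.
have /(leeD2l (f y)) : ((l * (1 - l) * v)%:E <= (l * (1 - l))%:E * phi r')%E.
  by rewrite EFinM lee_pmul2l.
move=> /le_trans/[apply].
have -> : maxe (f xbar) (f x') = f x' by apply/max_idPr; exact: xbarP.2 _ x'P.1.
rewrite -(fineK (f_fin Cy)) -(fineK (f_fin x'P.1)) -EFinD lee_fin => fy.
have := real_step Cy.
have -> : x - y = x - x' + l *: (x' - xbar).
  rewrite /y scalerBl scale1r scalerBr opprD opprB !addrA.
  by apply/rowP => i; rewrite !mxE; ring.
set E := enorm _ `^ p => st.
have : (p * g)^-1 * (p * g * (l * (1 - l)) * v + d `^ p) <= (p * g)^-1 * E.
  rewrite mulrDr -!(mulrA (p * g)) mulKf ?gt_eqF//; lra.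
by rewrite ler_pM2l ?invr_gt0.
Qed.

(** With [v = 0], moving from [x'] towards [xbar] does not bring the point closer to [x]; the
    first-order term of the squared distance is therefore nonnegative. *)
Lemma prox_dot_ge0 : 0 <= dr.
Proof.
suff : 0 <= 2 * dr by lra.
apply: (@le_of_le_addM _ _ _ (r' ^+ 2)) => l l0 l1.
have phi0 : (0%:E <= phi r')%E by have [h _ _] := phi_modulus; apply: h; exact: enorm_ge0.
have := prox_segment l0 l1 phi0; rewrite mulr0 add0r => dp.
have : d <= enorm (x - x' + l *: (x' - xbar)).
  rewrite leNgt; apply/negP => lt; move: dp; apply/negP; rewrite -ltNge.
  by apply: gt0_ltr_powR; rewrite ?nnegrE ?enorm_ge0.
rewrite -ler_sqr ?nnegrE ?enorm_ge0// enormD_sqr -/d -/dr -/r' -addrA lerDl.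
rewrite -mulrA mulrCA expr2 -mulrA -mulrDr pmulr_rge0//.
Qed.

(** The triangle inequality bounds the segment norm by [d + l * r'], whose p-th power has a known
    slope at 0. *)
Lemma prox_modulus_le v : (v%:E <= phi r')%E -> 0 < r' ->
  g * v <= r' * d `^ (p - 1).
Proof.
move=> vphi r'0; apply: powR_increment => //; first exact: enorm_ge0.
move=> l l0 l1; apply: le_trans (prox_segment l0 l1 vphi) _.
apply: ge0_ler_powR; rewrite ?nnegrE ?enorm_ge0 ?addr_ge0 ?mulr_ge0 ?enorm_ge0
  ?(ltW p_gt0) ?(ltW l0) ?(ltW r'0)//.
exact: enorm_triangle (ltW l0).
Qed.

(** For [p = 2] the segment norm expands exactly, and its first-order term keeps the inner
    product. *)
Lemma prox_modulus_le_dot v : p = 2 -> (v%:E <= phi r')%E -> g * v <= dr.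
Proof.
move=> p2 vphi.
apply: (@le_of_le_addM _ _ _ (g * v + r' ^+ 2 / 2)) => l l0 l1.
have := prox_segment l0 l1 vphi.
rewrite p2 !powR_mulrn ?enorm_ge0// enormD_sqr -/d -/dr -/r' => H.
have : l * (g * v) <= l * (dr + l * (g * v + r' ^+ 2 / 2)) by lra.
by rewrite ler_pM2l.
Qed.

End ProximalStep.

(** * Iteration counts from error recursions *)

Section Rates.
Variable R : realType.
Implicit Types (N : \bar R) (b e w L M : R).

Lemma nat_above b : exists2 k : nat,
  b <= k%:R & (k = 0%N \/ k%:R = (Num.ceil b)%:~R :> R).
Proof.
have [c0|c0] := lerP 0 (Num.ceil b).
  exists `|Num.ceil b|%N; rewrite natr_absz ger0_norm ?ceil_ge//; first by right.
exists 0%N; last by left.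
have c_le0 : (Num.ceil b)%:~R <= 0%:~R :> R by rewrite ler_int ltW.
exact: le_trans (ceil_ge b) c_le0.
Qed.

(** If [k] is the ceiling of [1 + b], then [k + 1] is that of [2 + b]. A negative ceiling is
    replaced by [k = 0], whence the maximum with 1. *)
Lemma le_max_ceile N b :
  (forall k : nat, 1 + b <= k%:R -> (N <= (k.+1%:R)%:E)%E) ->
  (N <= maxe 1 (ceile (2 + b)%:E))%E.
Proof.
move=> H; have [k kb kE] := nat_above (1 + b).
rewrite le_max; have := H k kb; case: kE => [->|kE]; first by move=> ->.
have -> : 2 + b = (1 + b) + 1 by ring.
by rewrite /= ceilDrz ?rpred1// ceil1 intrD -natr1 kE => ->; rewrite orbT.
Qed.

(** The infinite quotients occur at the degenerate starts: -oo for a zero initial error, +oo for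
    [u 0 = 1] in the superlinear case. *)
Lemma ninfty_div L : 0 < L -> (-oo / L%:E = -oo :> \bar R)%E.
Proof. by move=> L0; rewrite inver gt_eqF// mulNyr gtr0_sg ?invr_gt0// mul1e. Qed.

Lemma pinfty_div L : 0 < L -> (+oo / L%:E = +oo :> \bar R)%E.
Proof. by move=> L0; rewrite inver gt_eqF// mulyr gtr0_sg ?invr_gt0// mul1e. Qed.

(** * Geometric decay of the error *)

Section Linear.
(** [a k] is meant to control the gap at iterate [k + 1], hence the shift in [N_le]. *)
Variables (N : R -> \bar R) (a : nat -> R) (L : R).
Hypotheses (a_ge0 : forall k, 0 <= a k) (L_gt0 : 0 < L).
Hypothesis aS : forall k, a k.+1 <= expR (- L) * a k.
Hypothesis N_le : forall k e, 0 < e -> a k <= e -> (N e <= (k.+1%:R)%:E)%E.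

Let a_le k : a k <= expR (- (L * k%:R)) * a 0%N.
Proof.
elim: k => [|k IH]; first by rewrite mulr0 oppr0 expR0 mul1r.
apply: le_trans (aS k) _; apply: (@le_trans _ _ (expR (- L) * (expR (- (L * k%:R)) * a 0%N))).
  by rewrite ler_wpM2l ?expR_ge0.
by rewrite mulrA -expRD -natr1 mulrDr mulr1 opprD addrC.
Qed.

Let N_le_ln k e : 0 < e -> 0 < a 0%N ->
  (ln e^-1 + ln (a 0%N)) / L <= k%:R -> (N e <= (k.+1%:R)%:E)%E.
Proof.
move=> e0 a0; rewrite ler_pdivrMr// lnV ?posrE// => H.
apply: N_le => //; apply: le_trans (a_le k) _.
rewrite -{1}(lnK a0) -expRD -[leRHS]lnK// ler_expR; lra.
Qed.

Lemma linear_rate e : 0 < e ->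
  (N e <= maxe 1 (ceile (2 + (lne e^-1%:E + lne (a 0%N)%:E) / L%:E)))%E.
Proof.
move=> e0; have ei0 : 0 < e^-1 by rewrite invr_gt0.
rewrite (lne_EFin ei0).
have [a0|a0] := eqVneq (a 0%N) 0.
  (* A zero initial error sends the whole ceiling to -oo, so the 1 of the maximum must do; [k = 0]
     gives it. *)
  rewrite a0 (@le0_lneNy _ 0%:E)// addeNy ninfty_div// addeNy /= le_max.
  by apply/orP; left; apply: (N_le (k := 0)) => //; rewrite a0 ltW.
have a0p : 0 < a 0%N by rewrite lt_neqAle eq_sym a0 a_ge0.
have -> : (L%:E^-1 = L^-1%:E)%E by rewrite inver gt_eqF.
rewrite lne_EFin//.
apply: le_max_ceile => k kb; apply: N_le_ln => //; lra.
Qed.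

Lemma linear_rate_bigO : bigO_at0 N (fun e => ln e^-1).
Proof.
(* Once [ln e^-1] is at least 1, the fraction bounds the quotient and [3] absorbs the ceiling and
   the successor. *)
exists (3 + (1 + `|ln (a 0%N)|) / L).
near=> e.
have e0 : 0 < e by near: e; exact: nbhs_right_gt.
have eE : e <= expR (-1) by near: e; apply: nbhs_right_le; exact: expR_gt0.
have l1 : 1 <= ln e^-1.
  by rewrite -ler_expR lnK ?posrE ?invr_gt0// -[expR 1]invrK lef_pV2 ?posrE ?invr_gt0 ?expR_gt0// -expRN.
have nl := ler_norm (ln (a 0%N)); have n0 := normr_ge0 (ln (a 0%N)).
have K0 : 0 <= (1 + `|ln (a 0%N)|) / L by rewrite divr_ge0 ?addr_ge0// ltW.
rewrite (ger0_norm (le_trans ler01 l1)).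
have [a0|a0] := eqVneq (a 0%N) 0.
  apply: (@le_trans _ _ 1%:E); first by apply: (N_le (k := 0)) => //; rewrite a0 ltW.
  rewrite lee_fin; nra.
have a0p : 0 < a 0%N by rewrite lt_neqAle eq_sym a0 a_ge0.
have [k kb kE] := nat_above ((ln e^-1 + ln (a 0%N)) / L).
apply: le_trans (N_le_ln e0 a0p kb) _; rewrite lee_fin -natr1.
have H : (ln e^-1 + ln (a 0%N)) / L <= (1 + `|ln (a 0%N)|) / L * ln e^-1.
  rewrite mulrAC ler_pM2r ?invr_gt0//; nra.
case: kE => [->|->]; first nra.
have := ceilB1_lt ((ln e^-1 + ln (a 0%N)) / L); rewrite intrD /=; nra.
Unshelve. all: by end_near. Qed.

End Linear.

(** * Doubly exponential decay of the error *)

Section DoublyExponential.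
(** The shift [s] is 1 when the decay is counted from the first error and 2 when it is counted from
    the second. *)
Variables (N : R -> \bar R) (a : nat -> R) (M w alpha : R) (s : nat).
Hypotheses (M_gt0 : 0 < M) (w_gt0 : 0 < w) (alpha_gt1 : 1 < alpha).
Hypothesis a_le : forall k, a k <= M * expR (- (w * alpha ^+ k)).
Hypothesis N_le : forall k e, 0 < e -> a k <= e -> (N e <= ((k + s)%:R)%:E)%E.

Let N_le_lnln k e : 0 < e -> 0 < ln (M / e) ->
  (ln (ln (M / e)) - ln w) / ln alpha <= k%:R -> (N e <= ((k + s)%:R)%:E)%E.
Proof.
move=> e0 T0; have al0 : 0 < alpha by exact: lt_trans alpha_gt1.
rewrite ler_pdivrMr ?ln_gt0// mulr_natl -lnXn// => H.
apply: N_le => //; apply: le_trans (a_le k) _.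
have : ln (M / e) <= w * alpha ^+ k.
  rewrite -ler_ln ?posrE ?mulr_gt0 ?exprn_gt0// [ln (w * _)]lnM ?posrE ?exprn_gt0//; lra.
rewrite ln_div ?posrE// => H'.
rewrite -{1}(lnK M_gt0) -expRD -[leRHS]lnK// ler_expR; lra.
Qed.

Lemma doubly_exponential_rate e : s = 1%N -> 0 < e -> 0 < ln (M / e) ->
  (N e <= maxe 1 (ceile (2 + (ln (ln (M / e)) - ln w) / ln alpha)%:E))%E.
Proof.
move=> s1 e0 T0; apply: le_max_ceile => k kb.
have := @N_le_lnln k e e0 T0; rewrite s1 addn1; apply; lra.
Qed.

(** With l = ln(1/e) large, ln(M/e) = ln M + l is at most w l^2, so its logarithm exceeds ln w by at
    most 2 ln l. *)
Lemma doubly_exponential_rate_bigO : bigO_at0 N (fun e => ln (ln e^-1)).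
Proof.
have al0 : 0 < ln alpha by rewrite ln_gt0.
have s0 : 0 <= s%:R :> R by [].
(* Above [B], the product w l exceeds the constant needed for ln M + l <= w l^2. *)
pose B := (`|ln M| + 1) / w.
exists (s%:R + 1 + 2 / ln alpha).
near=> e.
have e0 : 0 < e by near: e; exact: nbhs_right_gt.
have big c : e <= expR (- c) -> c <= ln e^-1.
  move=> ec; rewrite lnV ?posrE// lerNr -[leRHS]expRK ler_ln ?posrE ?expR_gt0//.
have lM : `|ln M| + 1 <= ln e^-1.
  by apply: big; near: e; apply: nbhs_right_le; exact: expR_gt0.
have lB : B <= ln e^-1.
  by apply: big; near: e; apply: nbhs_right_le; exact: expR_gt0.
(* This makes ln(ln(1/e)) at least 1, so that it absorbs additive constants. *)
have lE : expR 1 <= ln e^-1.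
  by apply: big; near: e; apply: nbhs_right_le; exact: expR_gt0.
have e1 : 1 < expR 1 :> R by rewrite expR_gt1.
set l := ln e^-1 in lM lB lE *.
have l0 : 0 < l by lra.
have ll1 : 1 <= ln l by rewrite -[leLHS]expRK ler_ln ?posrE ?expR_gt0.
have nM := ler_norm (ln M); have nM' := ler_norm (- ln M); rewrite normrN in nM'.
have TE : ln (M / e) = ln M + l by rewrite lnM ?posrE ?invr_gt0.
have T0 : 0 < ln (M / e) by rewrite TE; lra.
have Tl : ln (M / e) <= w * l ^+ 2.
  have wB : w * B = `|ln M| + 1 by rewrite /B mulrC divfK ?gt_eqF.
  have := ler_pM2l w_gt0 B l; rewrite lB => wl.
  rewrite TE expr2 mulrA; nra.
rewrite (ger0_norm (le_trans ler01 ll1)).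
have H : (ln (ln (M / e)) - ln w) / ln alpha <= 2 / ln alpha * ln l.
  rewrite mulrAC ler_pM2r ?invr_gt0// lerBlDr.
  have : ln (ln (M / e)) <= ln (w * l ^+ 2) by rewrite ler_ln ?posrE ?mulr_gt0 ?exprn_gt0.
  rewrite [ln (w * _)]lnM ?posrE ?exprn_gt0// lnXn// mulr2n; lra.
have [k kb kE] := nat_above ((ln (ln (M / e)) - ln w) / ln alpha).
apply: le_trans (N_le_lnln e0 T0 kb) _; rewrite lee_fin natrD.
have K0 : 0 <= 2 / ln alpha by rewrite divr_ge0// ltW.
case: kE => [->|->]; first nra.
have := ceilB1_lt ((ln (ln (M / e)) - ln w) / ln alpha); rewrite intrD /=; nra.
Unshelve. all: by end_near. Qed.

End DoublyExponential.

Lemma doubly_exponential_decay (u : nat -> R) alpha w : 0 <= alpha ->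
  (forall k, 0 <= u k) -> u 0%N <= expR (- w) ->
  (forall k, u k.+1 <= u k `^ alpha) ->
  forall k, u k <= expR (- (w * alpha ^+ k)).
Proof.
move=> al0 u0 uw uS; elim=> [|k IH]; first by rewrite expr0 mulr1.
apply: le_trans (uS k) _.
rewrite exprSr mulrA -mulNr expRM.
by apply: ge0_ler_powR; rewrite ?nnegrE ?expR_ge0.
Qed.

End Rates.

(** * Contraction of the distances to the minimizer *)

(** The iterates may lie on the unit sphere, where the hypothesis is silent; monotonicity of [phi]
    extends the bound to 1 by a left limit. *)
Lemma powR_lower_bound_at1 (R : realType) (phi : R -> \bar R) (q rho : R) :
  modulus phi -> 1 < q -> 0 < rho ->
  (forall t, 0 <= t -> t < 1 -> ((rho * t `^ q)%:E <= phi t)%E) ->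
  ((rho * 1 `^ q)%:E <= phi 1%R)%E.
Proof.
move=> [_ phi_mono _] q1 rho0 H; rewrite powR1 mulr1.
have {}H l : 0 < l -> l < 1 -> ((rho * (1 - l) `^ q)%:E <= phi 1%R)%E.
  by move=> l0 l1; apply: le_trans (H (1 - l) _ _) (phi_mono _ _ _ _); lra.
case E : (phi 1) => [v| |]; rewrite ?leey//; last first.
  by have := H (1/2); rewrite E leeNy_eq => /(_ ltac:(lra) ltac:(lra)).
rewrite lee_fin; apply: (@le_of_le_addM _ _ _ (rho * q)) => l l0 l1.
have := H l l0 l1; rewrite E lee_fin.
have l0' : 0 <= 1 - l by lra.
have := powR_tangent q1 l0' ler01; rewrite !powR1; nra.
Qed.

Lemma powR_le1 (R : realType) (t s : R) : 0 <= s -> 0 <= t -> t <= 1 -> t `^ s <= 1.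
Proof.
move=> s0 t0 t1; have := ge0_ler_powR s0 t0 ler01 t1.
by rewrite powR1.
Qed.

(** Recursions are proved on logarithms, which requires treating a vanishing next distance apart. *)
Lemma powR_contraction (R : realType) (p L r r' : R) :
  0 < p -> 0 <= r' -> (0 < r' -> 0 < r /\ p * ln r' <= - L + p * ln r) ->
  r' `^ p <= expR (- L) * r `^ p.
Proof.
move=> p0 r'0 H; have [->|r'n0] := eqVneq r' 0.
  by rewrite powR0 ?gt_eqF// mulr_ge0 ?expR_ge0 ?powR_ge0.
have r'p : 0 < r' by rewrite lt_neqAle eq_sym r'n0.
have [rp le] := H r'p.
by rewrite /powR !gt_eqF// -expRD ler_expR.
Qed.

(** In logarithms the power inequality becomes linear, within reach of [lra] and [nra]. *)
Lemma ln_powR_le (R : realType) (g rho r d p q : R) :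
  0 < g -> 0 < rho -> 0 < r -> 0 < d ->
  g * (rho * r `^ q) <= r * d `^ (p - 1) ->
  ln (g * rho) + (q - 1) * ln r <= (p - 1) * ln d.
Proof.
move=> g0 rho0 r0 d0.
rewrite -ler_ln ?posrE ?mulr_gt0 ?powR_gt0// mulrA.
rewrite lnM ?posrE ?mulr_gt0 ?powR_gt0// [ln (r * _)]lnM ?posrE ?powR_gt0//.
rewrite !ln_powR; lra.
Qed.

Section Hippa.
Variables (R : realType) (n : nat) (f : 'rV[R]_n -> \bar R) (phi : R -> \bar R).
Variables (C : set 'rV[R]_n) (p gmin gmax : R) (gamma : nat -> R).
Implicit Types (q rho L e : R) (k : nat).
Variables (x : nat -> 'rV[R]_n) (xbar : 'rV[R]_n).
Hypotheses (f_proper : eproper f) (C_dom : C `<=` edom f).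
Hypothesis C_convex : convex_set (C : set (convex_lmodType 'rV[R]_n)).
Hypotheses (phi_modulus : modulus phi) (f_uqc : uniformly_quasiconvex phi C f).
Hypotheses (p_gt1 : 1 < p) (gmin_gt0 : 0 < gmin).
Hypotheses (x_hippa : hippa f C p gmin gmax gamma x) (xbarP : argmin C f xbar).

Let r k := enorm (x k - xbar).
(** Bounds the gap at [x k.+1], with [gmin] in place of [gamma k]. *)
Let a k := r k `^ p / (p * gmin).

Let p_gt0 : 0 < p. Proof. exact: lt_trans p_gt1. Qed.
Let pg_gt0 : 0 < p * gmin. Proof. by rewrite mulr_gt0. Qed.
Let gamma_gt k : gmin < gamma k. Proof. by have [] := x_hippa.2 k. Qed.
Let gamma_gt0 k : 0 < gamma k. Proof. exact: lt_trans (gamma_gt k). Qed.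
Let xP k : argmin C
  (fun y => (f y + ((p * gamma k)^-1 * enorm (x k - y) `^ p)%:E)%E) (x k.+1).
Proof. by have [] := x_hippa.2 k. Qed.
Let r_ge0 k : 0 <= r k. Proof. exact: enorm_ge0. Qed.

Lemma hippa_error_ge0 k : 0 <= a k.
Proof. by rewrite divr_ge0 ?powR_ge0// ltW. Qed.

(* [gmin < gamma k] being strict, [a k = e] is enough. *)
Lemma nb_iter_le k e : 0 < e -> a k <= e -> (nb_iter f xbar x e <= (k.+1%:R)%:E)%E.
Proof.
move=> e0 ae; apply: ereal_inf_lbound; exists k.+1 => //=.
apply: le_lt_trans (prox_gap_le f_proper C_dom p_gt1 (gamma_gt0 k) xbarP (xP k)) _.
rewrite lte_fin -/(r k).
have [r0|r0] := eqVneq (r k) 0; first by rewrite r0 powR0 ?gt_eqF// mulr0.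
apply: lt_le_trans ae; rewrite mulrC /a ltr_pM2l; last first.
  by rewrite powR_gt0// lt_neqAle eq_sym r0 r_ge0.
by rewrite ltf_pV2 ?posrE ?mulr_gt0// ltr_pM2l.
Qed.

Lemma hippa_displacement_le k : enorm (x k - x k.+1) <= r k.
Proof. exact: prox_displacement_le f_proper C_dom p_gt1 (gamma_gt0 k) xbarP (xP k). Qed.

Lemma hippa_ln q rho k : 0 < rho ->
  ((rho * r k.+1 `^ q)%:E <= phi (r k.+1))%E -> 0 < r k.+1 ->
  0 < enorm (x k - x k.+1) /\
  ln (gmin * rho) + (q - 1) * ln (r k.+1) < (p - 1) * ln (enorm (x k - x k.+1)).
Proof.
move=> rho0 Hphi r'0; set d := enorm _.
have := prox_modulus_le f_proper C_dom C_convex f_uqc p_gt1 (gamma_gt0 k) xbarP (xP k) Hphi r'0.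
rewrite -/(r _) -/d => H.
have lhs0 : 0 < gamma k * (rho * r k.+1 `^ q) by rewrite !mulr_gt0// powR_gt0.
(* A zero step would annihilate the right side, as [p - 1 > 0], against a positive left side. *)
have d0 : 0 < d.
  rewrite lt_neqAle enorm_ge0 andbT eq_sym; apply/eqP => d0.
  move: H; rewrite d0 powR0 ?mulr0; last by rewrite gt_eqF// subr_gt0.
  by rewrite leNgt lhs0.
split=> //; apply: lt_le_trans (ln_powR_le (gamma_gt0 k) rho0 r'0 d0 H).
by rewrite ltrD2r ltr_ln ?posrE ?mulr_gt0// ltr_pM2r.
Qed.

Lemma hippa_ln_le q rho k : 0 < rho ->
  ((rho * r k.+1 `^ q)%:E <= phi (r k.+1))%E -> 0 < r k.+1 ->
  0 < r k /\ ln (gmin * rho) + (q - 1) * ln (r k.+1) < (p - 1) * ln (r k).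
Proof.
move=> rho0 Hphi r'0; have [d0 H] := hippa_ln rho0 Hphi r'0.
have dr := hippa_displacement_le k; have rk0 := lt_le_trans d0 dr.
split=> //; apply: lt_le_trans H _.
by rewrite ler_pM2l ?subr_gt0// ler_ln.
Qed.

(** Common end of the three linear regimes, which differ only in the rate [L]. *)
Lemma hippa_linear L : 0 < L ->
  (forall k, 0 < r k.+1 -> 0 < r k /\ p * ln (r k.+1) <= - L + p * ln (r k)) ->
  (forall e, 0 < e -> (nb_iter f xbar x e <=
    maxe 1 (ceile (2 + (lne e^-1%:E + lne (a 0%N)%:E) / L%:E)))%E) /\
  bigO_at0 (nb_iter f xbar x) (fun e => ln e^-1).
Proof.
move=> L0 H; have aS k : a k.+1 <= expR (- L) * a k.
  rewrite /a mulrA ler_pM2r ?invr_gt0//.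
  exact: powR_contraction (r_ge0 _) (H k).
split=> [e e0|].
  exact: (linear_rate hippa_error_ge0 L0 aS nb_iter_le).
exact: (linear_rate_bigO hippa_error_ge0 L0 aS nb_iter_le).
Qed.

Lemma hippa_linear_ball q rho : 1 < q -> 0 < rho ->
  (forall t, 0 <= t -> t < 1 -> ((rho * t `^ q)%:E <= phi t)%E) ->
  q <= p -> rho^-1 < gmin -> (forall k, r k <= 1) ->
  forall k, 0 < r k.+1 -> 0 < r k /\
   p * ln (r k.+1) <= - (p * ((p - 1)^-1 * ln (rho * gmin))) + p * ln (r k).
Proof.
move=> q1 rho0 Hphi qp rg r1 k r'0.
have Hk : ((rho * r k.+1 `^ q)%:E <= phi (r k.+1))%E.
  have [rlt|rge] := ltP (r k.+1) 1; first exact: Hphi.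
  have -> : r k.+1 = 1 by apply/eqP; rewrite eq_le r1 rge.
  exact: powR_lower_bound_at1.
have [rk0 H] := hippa_ln_le rho0 Hk r'0; split=> //.
rewrite -mulrN -mulrDr ler_pM2l// -lerBlDr lerNr.
have p1 : 0 < p - 1 by rewrite subr_gt0.
rewrite mulrC ler_pdivrMr//.
(* In the unit ball this sign allows [q - 1] to be replaced by the larger [p - 1]. *)
have : ln (r k.+1) <= 0 by rewrite ln_le0.
rewrite (mulrC rho); nra.
Qed.

Lemma hippa_linear_quadratic rho : 0 < rho ->
  (forall t, 0 <= t -> ((rho * t `^ 2)%:E <= phi t)%E) -> p = 2 ->
  forall k, 0 < r k.+1 -> 0 < r k /\
   p * ln (r k.+1) <= - (p * ln (1 + rho * gmin)) + p * ln (r k).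
Proof.
move=> rho0 Hphi p2 k r'0.
have := prox_modulus_le_dot f_proper C_dom C_convex f_uqc p_gt1 (gamma_gt0 k) xbarP
  (xP k) p2 (Hphi _ (r_ge0 k.+1)).
have := dot_le_enorm (x k - xbar) (x k.+1 - xbar).
have -> : x k - xbar = (x k - x k.+1) + (x k.+1 - xbar) by rewrite addrA subrK.
rewrite dotDl -enorm_sqr addrA subrK -/(r k) -/(r k.+1) powR_mulrn//.
set s := dot _ _ => cs Hs.
have rg : rho * gmin < rho * gamma k by rewrite ltr_pM2l.
have rg0 : 0 < rho * gmin by rewrite mulr_gt0.
(* Cauchy-Schwarz reads s + r'^2 <= r r', and s is at least gamma rho r'^2; dividing by r' gives the
   rate. *)
have key : (1 + rho * gmin) * r k.+1 <= r k.
  rewrite -(ler_pM2r r'0); have := mulr_gt0 r'0 r'0; nra.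
have rk0 : 0 < r k by apply: lt_le_trans key; rewrite mulr_gt0//; lra.
split=> //; rewrite -mulrN -mulrDr ler_pM2l// addrC -[leRHS]ln_div ?posrE//; last lra.
rewrite ler_ln ?posrE ?divr_gt0//; try lra.
rewrite ler_pdivlMr; last lra.
by rewrite mulrC.
Qed.

(* Beyond [rho * gmin > 1], the obtuse angle at [x k.+1] gives
   [r k >= Num.sqrt 2 * r k.+1]; the exponent [p - 1] of that factor absorbs [sigma]. *)
Lemma hippa_linear_high_order rho : 2 < p -> 0 < rho ->
  (forall t, 0 <= t -> ((rho * t `^ p)%:E <= phi t)%E) -> rho^-1 < gmin ->
  let sigma := (1 / 2) `^ ((3 * p - 2) / 2) in
  forall k, 0 < r k.+1 -> 0 < r k /\
   p * ln (r k.+1) <=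
   - (1 / (p - 1) * (ln (p * gmin * rho + sigma) - ln p)) + p * ln (r k).
Proof.
move=> p2 rho0 Hphi rg sigma k r'0.
have [d0 H] := hippa_ln rho0 (Hphi _ (r_ge0 _)) r'0.
have [rk0 H'] := hippa_ln_le rho0 (Hphi _ (r_ge0 _)) r'0.
split=> //; set d := enorm _ in d0 H.
have p1 : 0 < p - 1 by rewrite subr_gt0.
have s1 : 1 < gmin * rho by rewrite -ltr_pdivrMr// div1r.
have lns : 0 < ln (gmin * rho) by rewrite ln_gt0.
have r'd : r k.+1 < d.
  by rewrite -ltr_ln ?posrE// -(ltr_pM2l p1); lra.
(* Expanding r^2 around [x k.+1] and dropping the nonnegative inner product leaves d^2 + r'^2, with
   d > r'. *)
have r2 : 2 * r k.+1 ^+ 2 <= r k ^+ 2.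
  have := prox_dot_ge0 f_proper C_dom C_convex phi_modulus f_uqc p_gt1 (gamma_gt0 k) xbarP (xP k).
  have := enormD_sqr (x k - x k.+1) (x k.+1 - xbar) 1.
  rewrite scale1r addrA subrK -/(r k) -/(r k.+1) -/d.
  have : r k.+1 ^+ 2 <= d ^+ 2 by rewrite ler_sqr ?nnegrE// ?ltW// ltW.
  set D := dot _ _; lra.
have ln2 : 1 / 2 <= ln 2 :> R.
  have := @le_ln1Dx R (- (1 / 2)) ltac:(lra).
  have -> : 1 + - (1 / 2) = 2^-1 :> R by lra.
  rewrite lnV ?posrE//; lra.
have r2ln : ln 2 + 2 * ln (r k.+1) <= 2 * ln (r k).
  move: r2; rewrite -ler_ln ?posrE ?mulr_gt0 ?exprn_gt0//.
  by rewrite lnM ?posrE ?exprn_gt0// !lnXn// !mulr2n; lra.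
(* The exponent (3p-2)/2 exceeds 2 because [p > 2]. *)
have sg : sigma <= 1 / 4.
  rewrite /sigma; apply: (@le_trans _ _ ((1 / 2) `^ 2%:R)).
    by apply: ger_powR; lra.
  by rewrite powR_mulrn ?expr2; lra.
have sg0 : 0 <= sigma by exact: powR_ge0.
(* Since p gmin rho > 2, adding [sigma] changes the logarithm by at most (1/4)/2. *)
have lnsg : ln (p * gmin * rho + sigma) - ln p <= ln (gmin * rho) + 1 / 8.
  have pgr : 2 < p * (gmin * rho) by nra.
  have -> : p * gmin * rho + sigma = p * (gmin * rho) * (1 + sigma / (p * (gmin * rho))).
    by field; rewrite !gt_eqF.
  have t0 : 0 <= sigma / (p * (gmin * rho)) by rewrite divr_ge0// ltW// (lt_trans _ pgr).
  have t1 : sigma / (p * (gmin * rho)) <= 1 / 8.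
    by rewrite ler_pdivrMr; nra.
  have := @le_ln1Dx R (sigma / (p * (gmin * rho))) ltac:(lra).
  rewrite lnM ?posrE; [|nra|lra].
  rewrite [ln (p * _)]lnM ?posrE//; [lra|nra].
suff : 1 / (p - 1) * (ln (p * gmin * rho + sigma) - ln p)
       <= p * (ln (r k) - ln (r k.+1)) by lra.
(* With D = ln r - ln r', split p(p-1)D into (p-1)D, which exceeds ln(gmin rho), and (p-1)^2 D,
   which exceeds 1/8 because D >= (ln 2)/2 >= 1/4. *)
rewrite mul1r mulrC ler_pdivrMr//.
have e1 : (p - 1) * (ln 2 / 2) <= (p - 1) * (ln (r k) - ln (r k.+1)) by rewrite ler_pM2l//; lra.
have e2 : 1 * (p - 1) * (1 / 4) <= (p - 1) * ((p - 1) * (ln (r k) - ln (r k.+1))).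
  by rewrite -mulrA mul1r ler_pM2l//; nra.
lra.
Qed.

(** * Superlinear convergence for [q < p] *)

Section Superlinear.
Variables q rho : R.
Hypotheses (q_ge2 : 2 <= q) (rho_gt0 : 0 < rho) (q_lt_p : q < p).
Hypothesis phi_ge : forall t, 0 <= t -> ((rho * t `^ q)%:E <= phi t)%E.

Let c := (gmin * rho) `^ (- 1 / (q - 1)).
Let alpha := (p - 1) / (q - 1).
Hypothesis r0_le : r 0%N <= c `^ (- ((q - 1) / (p - q))).

(** This rescaling absorbs [c]: the recursion r' < c r^alpha becomes u' < u^alpha. The constant [M]
    converts back, through a = M u^p. *)
Let u k := c `^ (1 / (alpha - 1)) * r k.
Let M := c `^ (- (p / (alpha - 1))) * (p * gmin)^-1.

Let q1_gt0 : 0 < q - 1. Proof. by rewrite subr_gt0 (lt_le_trans _ q_ge2)// ltr1n. Qed.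
Let pq_gt0 : 0 < p - q. Proof. by rewrite subr_gt0. Qed.
Let c_gt0 : 0 < c. Proof. by rewrite powR_gt0// mulr_gt0. Qed.
Let M_gt0 : 0 < M.
Proof. by apply: mulr_gt0; [exact: powR_gt0|rewrite invr_gt0]. Qed.
Let alpha1E : alpha - 1 = (p - q) / (q - 1).
Proof. by rewrite /alpha; field; rewrite gt_eqF. Qed.
Let alpha1_gt0 : 0 < alpha - 1. Proof. by rewrite alpha1E divr_gt0. Qed.
Let alpha_gt1 : 1 < alpha. Proof. by rewrite -subr_gt0. Qed.
Let alpha_ge0 : 0 <= alpha. Proof. exact: le_trans ler01 (ltW alpha_gt1). Qed.
Let u_ge0 k : 0 <= u k. Proof. by rewrite mulr_ge0 ?powR_ge0. Qed.

(** Restates the radius condition, since 1/(alpha-1) = (q-1)/(p-q). *)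
Let u0_le1 : u 0%N <= 1.
Proof.
apply: (@le_trans _ _ (c `^ (1 / (alpha - 1)) * c `^ (- ((q - 1) / (p - q))))).
  by rewrite ler_pM2l // powR_gt0.
rewrite alpha1E -powRD; last by rewrite (gt_eqF c_gt0) implybT.
have -> : 1 / ((p - q) / (q - 1)) + - ((q - 1) / (p - q)) = 0.
  by field; rewrite !gt_eqF.
by rewrite powRr0.
Qed.

Let u_lt k : 0 < r k.+1 -> u k.+1 < u k `^ alpha.
Proof.
move=> r'0; have [rk0 H] := hippa_ln_le rho_gt0 (phi_ge (r_ge0 _)) r'0.
have c'0 : 0 < c `^ (1 / (alpha - 1)) by rewrite powR_gt0.
rewrite -ltr_ln ?posrE ?powR_gt0 ?mulr_gt0//.
rewrite ln_powR (lnM c'0 r'0) (lnM c'0 rk0) (ln_powR c).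
have lnc : ln (gmin * rho) = - (q - 1) * ln c.
  by rewrite /c ln_powR; field; rewrite gt_eqF.
have qa : (q - 1) * alpha = p - 1 by rewrite /alpha mulrC divfK// gt_eqF.
have : ln (r k.+1) < ln c + alpha * ln (r k).
  rewrite -(ltr_pM2l q1_gt0); rewrite lnc in H; rewrite mulrDr mulrA qa; lra.
have : 1 / (alpha - 1) * (alpha - 1) = 1 by rewrite divfK// gt_eqF.
move: (1 / _) => kappa ka.
have -> : alpha * (kappa * ln c + ln (r k)) =
  kappa * ln c + (kappa * (alpha - 1)) * ln c + alpha * ln (r k) by ring.
rewrite ka; lra.
Qed.

Let u_le k : u k.+1 <= u k `^ alpha.
Proof.
have [r0|r0] := eqVneq (r k.+1) 0; first by rewrite /u r0 mulr0 powR_ge0.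
by apply: ltW; apply: u_lt; rewrite lt_neqAle eq_sym r0 r_ge0.
Qed.

Let aE k : a k = M * u k `^ p.
Proof.
have cc : c `^ (- (p / (alpha - 1))) * (c `^ (1 / (alpha - 1))) `^ p = 1.
  rewrite -powRrM -powRD; last by rewrite (gt_eqF c_gt0) implybT.
  have -> : - (p / (alpha - 1)) + 1 / (alpha - 1) * p = 0 by ring.
  exact: powRr0.
by rewrite /u powRM ?powR_ge0// /M mulrACA cc mul1r mulrC.
Qed.

(** The starting index [s] is free because the asymptotic bound must start at [u 1]. *)
Let a_le (s : nat) w : u s <= expR (- w) ->
  forall k, a (k + s)%N <= M * expR (- (p * w * alpha ^+ k)).
Proof.
move=> us k; rewrite aE ler_pM2l//.
have uk := doubly_exponential_decay alpha_ge0 (fun j => u_ge0 (j + s)) us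
  (fun j => u_le (j + s)) k.
rewrite -mulrA mulrC -mulNr expRM.
by apply: ge0_ler_powR; rewrite ?nnegrE ?expR_ge0// ltW.
Qed.

Let a0_le_M : a 0%N <= M.
Proof.
by rewrite aE ler_piMr ?(ltW M_gt0)// powR_le1// ltW.
Qed.

Let u0_gt0 e : 0 < e -> e <= a 0%N -> 0 < u 0%N.
Proof.
move=> e0 ea; have : 0 < a 0%N by exact: lt_le_trans ea.
by rewrite aE pmulr_rgt0// => /(gt0_powR p_gt0 (u_ge0 0%N)).
Qed.

(** Logarithm of u0^(-p) <= M/e, which is e <= M u0^p = a 0. *)
Let ln_T_ge e : 0 < e -> e <= a 0%N -> p * (- ln (u 0%N)) <= ln (M / e).
Proof.
move=> e0 ea; have u0 := u0_gt0 e0 ea.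
have [T0 T0'] : 0 < M / e /\ 0 < e / M by split; exact: divr_gt0.
have u0p : 0 < u 0%N `^ p by exact: powR_gt0.
rewrite mulrN lerNl -(lnV T0) invf_div -ln_powR.
by rewrite (ler_ln T0' u0p) ler_pdivrMr// mulrC -aE.
Qed.

Lemma hippa_superlinear e : 0 < e ->
  (nb_iter f xbar x e <= maxe 1 (ceile (2 +
    (lne (lne (M * e^-1)%:E) - lne (p%:E * lne ((u 0%N)%:E^-1)))
      / (ln alpha)%:E)))%E.
Proof.
move=> e0; have [ae|ea] := leP (a 0%N) e.
  by rewrite le_max; apply/orP; left; exact: (@nb_iter_le 0).
have u0 := u0_gt0 e0 (ltW ea).
have lnal : 0 < ln alpha by rewrite ln_gt0.
(* As [u 0 <= 1], [M] dominates [a 0], which exceeds [e]. *)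
have T0 : 0 < ln (M / e) by rewrite ln_gt0// ltr_pdivlMr// mul1r (lt_le_trans ea).
have -> : ((u 0%N)%:E^-1 = (u 0%N)^-1%:E)%E by rewrite inver gt_eqF.
have ui0 : 0 < (u 0%N)^-1 by rewrite invr_gt0.
rewrite (lne_EFin (divr_gt0 M_gt0 e0)) (lne_EFin T0) (lne_EFin ui0) (lnV u0).
(* At [u 0 = 1] the subtracted logarithm is -oo and the stated bound is +oo. *)
have [lu|lu] := eqVneq (ln (u 0%N)) 0.
  rewrite lu oppr0 mule0 (@le0_lneNy _ 0%E)// pinfty_div//.
  by rewrite le_max leey orbT.
have w0 : 0 < - ln (u 0%N).
  by rewrite oppr_gt0 lt_neqAle lu ln_le0.
rewrite -EFinM lne_EFin ?mulr_gt0//.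
have -> : ((ln alpha)%:E^-1 = (ln alpha)^-1%:E)%E by rewrite inver gt_eqF.
have us : u 0%N <= expR (- - ln (u 0%N)) by rewrite opprK lnK.
have H := a_le us; have pw0 : 0 < p * - ln (u 0%N) by rewrite mulr_gt0.
apply: (@doubly_exponential_rate _ _ a M _ _ 1 M_gt0 pw0 alpha_gt1 _ _ e erefl e0 T0).
  by move=> k; have := H k; rewrite addn0.
by move=> k e' e'0; rewrite addn1; exact: nb_iter_le.
Qed.

Lemma hippa_superlinear_lnln_ge e : 0 < e -> e <= a 0%N ->
  (lne (p%:E * lne ((u 0%N)%:E^-1)) <= lne (lne (M * e^-1)%:E))%E.
Proof.
move=> e0 ea; have u0 := u0_gt0 e0 ea.
have -> : ((u 0%N)%:E^-1 = (u 0%N)^-1%:E)%E by rewrite inver gt_eqF.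
have ui0 : 0 < (u 0%N)^-1 by rewrite invr_gt0.
rewrite (lne_EFin (divr_gt0 M_gt0 e0)) (lne_EFin ui0) (lnV u0).
have [lu|lu] := eqVneq (ln (u 0%N)) 0.
  by rewrite lu oppr0 mule0 (@le0_lneNy _ 0%E)// leNye.
have w0 : 0 < p * - ln (u 0%N).
  by rewrite mulr_gt0// oppr_gt0 lt_neqAle lu ln_le0.
have T0 := lt_le_trans w0 (ln_T_ge e0 ea).
by rewrite -EFinM !lne_EFin// lee_fin ler_ln ?posrE// ln_T_ge.
Qed.

(* [u 0 = 1] is allowed, but then [u 1 < 1] because [gmin < gamma 0] is strict. *)
Lemma hippa_superlinear_bigO :
  bigO_at0 (nb_iter f xbar x) (fun e => ln (ln e^-1)).
Proof.
have u1 : u 1%N < 1.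
  have [r1|r1] := eqVneq (r 1%N) 0; first by rewrite /u r1 mulr0.
  have /u_lt : 0 < r 1%N by rewrite lt_neqAle eq_sym r1 r_ge0.
  by move/lt_le_trans; apply; exact: powR_le1.
(* The floor 1/2 keeps [m] positive when [u 1 = 0]. *)
pose m := Num.max (u 1%N) (1 / 2).
have m0 : 0 < m by rewrite lt_max divr_gt0 ?orbT.
have m1 : m < 1 by rewrite gt_max u1/=; lra.
have w0 : 0 < - ln m by rewrite oppr_gt0 ln_lt0// m0.
have us : u 1%N <= expR (- - ln m) by rewrite opprK lnK// le_max lexx.
have pw0 : 0 < p * - ln m by rewrite mulr_gt0.
apply: (@doubly_exponential_rate_bigO _ _ (fun k => a (k + 1)) M _ _ 2 M_gt0 pw0 alpha_gt1).
  exact: a_le us.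
by move=> k e' e'0; rewrite addn1 addn2; exact: nb_iter_le.
Qed.

End Superlinear.

End Hippa.

(** Extended logarithms give the degenerate starts a meaning. The maximum with 1 covers a ceiling
    below 1, since the estimates control the gap only from [x 1] on. *)
Theorem theorem4p15 (R : realType) (n : nat)
    (f : 'rV[R]_n -> \bar R) (phi : R -> \bar R) (C : set 'rV[R]_n)
    (p gmin gmax : R) (gamma : nat -> R) (x : nat -> 'rV[R]_n)
    (xbar : 'rV[R]_n)
    (f_proper : eproper f) (f_lsc : lower_semicontinuous f)
    (f_coercive : coercive f)
    (C_neq0 : C !=set0) (C_closed : closed C)
    (C_convex : convex_set (C : set (convex_lmodType 'rV[R]_n)))
    (C_dom : C `<=` edom f)
    (phi_modulus : modulus phi) (f_uqc : uniformly_quasiconvex phi C f)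
    (p_gt1 : 1 < p) (gmin_gt0 : 0 < gmin) (gmin_lt_gmax : gmin < gmax)
    (x_hippa : hippa f C p gmin gmax gamma x)
    (xbar_argmin : argmin C f = [set xbar]) :
  let N := nb_iter f xbar x in
  let r0 := enorm (x 0%N - xbar) in
  let D := r0 `^ p / (p * gmin) in
  [/\ forall q rho : R, 1 < q -> q < 2 -> 0 < rho ->
        (forall t, 0 <= t -> t < 1 -> ((rho * t `^ q)%:E <= phi t)%E) ->
        q <= p -> p < 2 -> rho^-1 < gmin ->
        (forall k, enorm (x k - xbar) <= 1) ->
        let mu := (rho * gmin) `^ (- (p - 1)^-1) in
        (forall e : R, 0 < e -> e < 1 ->
          (N e <= maxe 1 (ceile (2 + (lne e^-1%:E + lne D%:E)
                                     / (p * ln (1 / mu))%:E)))%E) /\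
        bigO_at0 N (fun e => ln e^-1),
      forall rho : R, 0 < rho ->
        (forall t, 0 <= t -> ((rho * t `^ 2)%:E <= phi t)%E) ->
        p = 2 ->
        (forall e : R, 0 < e ->
          (N e <= maxe 1 (ceile (2 + (lne e^-1%:E + lne D%:E)
                                     / (p * ln (1 + rho * gmin))%:E)))%E) /\
        bigO_at0 N (fun e => ln e^-1),
      forall rho : R, 2 < p -> 0 < rho ->
        (forall t, 0 <= t -> ((rho * t `^ p)%:E <= phi t)%E) ->
        rho^-1 < gmin ->
        let sigma := (1 / 2) `^ ((3 * p - 2) / 2) in
        (forall e : R, 0 < e ->
          (N e <= maxe 1 (ceile (2 + (lne e^-1%:E + lne D%:E)
                  / (1 / (p - 1) * (ln (p * gmin * rho + sigma) - ln p))%:E)))%E)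
        /\ bigO_at0 N (fun e => ln e^-1) &
      forall q rho : R, 2 <= q -> 0 < rho ->
        (forall t, 0 <= t -> ((rho * t `^ q)%:E <= phi t)%E) ->
        q < p ->
        let c := (gmin * rho) `^ (- 1 / (q - 1)) in
        r0 <= c `^ (- ((q - 1) / (p - q))) ->
        let alpha := (p - 1) / (q - 1) in
        let u0 := c `^ (1 / (alpha - 1)) * r0 in
        let T (e : R) := c `^ (- (p / (alpha - 1))) * (p * gmin)^-1 * e^-1 in
        [/\ forall e : R, 0 < e ->
              (N e <= maxe 1 (ceile (2 +
                  (lne (lne (T e)%:E) - lne (p%:E * lne (u0%:E^-1)))
                    / (ln alpha)%:E)))%E,
            forall e : R, 0 < e -> e <= D ->
              (lne (p%:E * lne (u0%:E^-1)) <= lne (lne (T e)%:E))%E &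
            bigO_at0 N (fun e => ln (ln e^-1))]].
Proof.
move=> N r0 D; have xbarP : argmin C f xbar by rewrite xbar_argmin.
have p1 : 0 < p - 1 by rewrite subr_gt0.
have p0 : 0 < p by exact: lt_trans p_gt1.
split.
- move=> q rho q1 q2 rho0 Hphi qp p2 rg ball mu.
  have s1 : 1 < rho * gmin by rewrite -ltr_pdivrMl// mulr1.
  have -> : ln (1 / mu) = (p - 1)^-1 * ln (rho * gmin).
    by rewrite div1r lnV ?posrE ?powR_gt0 ?mulr_gt0// ln_powR mulNr opprK.
  have L0 : 0 < p * ((p - 1)^-1 * ln (rho * gmin)).
    by rewrite !mulr_gt0 ?invr_gt0// ln_gt0.
  have [H1 H2] := hippa_linear f_proper C_dom p_gt1 gmin_gt0 x_hippa xbarP L0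
    (hippa_linear_ball f_proper C_dom C_convex phi_modulus f_uqc p_gt1 gmin_gt0
      x_hippa xbarP q1 rho0 Hphi qp rg ball).
  by split=> // e e0 _; exact: H1.
- move=> rho rho0 Hphi p2.
  have L0 : 0 < p * ln (1 + rho * gmin).
    by rewrite mulr_gt0// ln_gt0// ltrDl mulr_gt0.
  exact (hippa_linear f_proper C_dom p_gt1 gmin_gt0 x_hippa xbarP L0
    (hippa_linear_quadratic f_proper C_dom C_convex f_uqc p_gt1 gmin_gt0
      x_hippa xbarP rho0 Hphi p2)).
- move=> rho p2 rho0 Hphi rg sigma.
  have s1 : 1 < gmin * rho by rewrite -ltr_pdivrMr// div1r.
  have sg0 : 0 <= sigma by exact: powR_ge0.
  have L0 : 0 < 1 / (p - 1) * (ln (p * gmin * rho + sigma) - ln p).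
    rewrite mulr_gt0 ?divr_gt0// subr_gt0 ltr_ln ?posrE//; nra.
  exact (hippa_linear f_proper C_dom p_gt1 gmin_gt0 x_hippa xbarP L0
    (hippa_linear_high_order f_proper C_dom C_convex phi_modulus f_uqc p_gt1
      gmin_gt0 x_hippa xbarP p2 rho0 Hphi rg)).
- move=> q rho q2 rho0 Hphi qp c r0c alpha u0 T; split.
  + exact (hippa_superlinear f_proper C_dom C_convex f_uqc p_gt1 gmin_gt0
      x_hippa xbarP q2 rho0 qp Hphi r0c).
  + exact (hippa_superlinear_lnln_ge p_gt1 gmin_gt0 q2 rho0 qp r0c).
  + exact (hippa_superlinear_bigO f_proper C_dom C_convex f_uqc p_gt1 gmin_gt0
      x_hippa xbarP q2 rho0 qp Hphi r0c).
Qed.
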